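(* Let $f:[0,+\infty)\to\mathbb R$ be a function. 1. If $f$ is of bounded variation, then for every $n\in\mathbb N$ $$\sum_{0\le k<n}f(k)=\gamma^f+\int_0^n f(x)\,dx+\varepsilon_1'(n),\qquad |\varepsilon_1'(n)|\le\mathrm{pV}(f,[n,+\infty)),$$ that is, the real number $\varepsilon_1'(n)$ defined by the equality satisfies the inequality. 2. If $f$ is monotonic and unbounded, then, for $n\in\mathbb N$, $$\sum_{0\le k<n}f(k)=\int_0^n f(x)\,dx+O(f(n))\qquad\text{as } n\to+\infty.$$
   Context: For a real-valued function $f$ on an interval $I$, the pointwise variation of $f$ on $I$ is $$\mathrm{pV}(f,I):=\sup\Big\{\sum_{0\le i<m}|f(t_{i+1})-f(t_i)|:\ t_i\in I,\ t_0<t_1<\dots<t_m\Big\},$$ and $f$ is of bounded variation on $I$ if $\mathrm{pV}(f,I)<+\infty$. $\mathbb N=\{0,1,2,\dots\}$, and $\sum_{0\le k<n}f(k)=\sum_{k=0}^{n-1}f(k)$ (empty sum equal to $0$). For $f$ of bounded variation on $[0,+\infty)$, the Euler constant of $f$ is $$\gamma^f:=\lim_{n\to+\infty}\Big(\sum_{0\le k<n}f(k)-\int_0^n f(x)\,dx\Big),$$ a limit which exists and is finite for such $f$. *)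

(* Defs.v *)
From mathcomp Require Import all_boot all_order all_algebra.
From mathcomp Require Import all_classical all_reals all_analysis.
Set Implicit Arguments.
Unset Strict Implicit.
Unset Printing Implicit Defensive.
Import Order.TTheory GRing.Theory Num.Theory.
Import numFieldNormedType.Exports.
Local Open Scope classical_set_scope.
Local Open Scope ring_scope.

(* The library's [total_variation] only covers compact intervals. Allowing
   m = 0 adds only the value 0, so the supremum is unaffected when I has at
   least two points (and is 0 when I is a single point). *)
Definition pointwise_variation (R : realType) (f : R -> R) (I : interval R)
    : \bar R :=
  ereal_sup [set v | exists m (t : nat -> R),
    [/\ forall i, (i <= m)%N -> t i \in I,
        forall i, (i < m)%N -> t i < t i.+1 &
        v = (\sum_(0 <= i < m) `|f (t i.+1) - f (t i)|)%:E]].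

Definition bounded_pV (R : realType) (f : R -> R) (I : interval R) : Prop :=
  (pointwise_variation f I < +oo)%E.

Definition sum_upto (R : realType) (f : R -> R) (n : nat) : R :=
  \sum_(0 <= k < n) f k%:R.

(* Lebesgue integral over [0, n]; it agrees with the Riemann integral whenever
   the latter exists, as it does for f of bounded variation or monotonic. *)
Definition int_upto (R : realType) (f : R -> R) (n : nat) : R :=
  (\int[lebesgue_measure]_(x in `[0%R, n%:R]) f x)%R.

Definition euler_constant (R : realType) (f : R -> R) : R :=
  lim ((fun n => sum_upto f n - int_upto f n) @ \oo).

Definition monotonic_on (R : realType) (f : R -> R) (I : interval R) : Prop :=
  {in I &, {homo f : x y / x <= y}} \/ {in I &, {homo f : x y /~ x <= y}}.

(* Main.v *)
(* On [k, k+1] the function f stays within its variation TV(f, [k, k+1]) of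
   f(k), so the difference D(n) between the sum and the integral moves by at
   most TV(f, [k, k+1]) from k to k+1. Additivity of the variation then gives
   |D(m) - D(n)| <= TV(f, [n, m]) whenever n <= m. For f of bounded variation on
   [0, +oo[ this makes D converge, and letting m tend to infinity bounds the
   error at n. For f monotonic, |D(n)| <= |f(n) - f(0)|, and unboundedness
   forces |f(0)| <= |f(n)| for large n. *)
Require Import Defs.
From mathcomp Require Import all_boot all_order all_algebra.
From mathcomp Require Import all_classical all_reals all_analysis.
From mathcomp Require Import measurable_realfun ring lra.
Set Implicit Arguments.
Unset Strict Implicit.
Unset Printing Implicit Defensive.
Import Order.TTheory GRing.Theory Num.Theory.
Import numFieldNormedType.Exports.
Local Open Scope classical_set_scope.
Local Open Scope ring_scope.

(** * Integrability of functions of bounded variation *)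

Lemma nondecreasing_in_measurable {R : realType} (I : interval R) (f : R -> R) :
  {in I &, nondecreasing_fun f} -> measurable_fun [set` I] f.
Proof.
move=> ndf.
apply: (measurability (@RGenCInfty.G R)) => [|/= _ [_] [r] -> <-].
  exact: RGenCInfty.measurableE.
(* Rays [[r, +oo[] generate the Borel sets, and by monotonicity the preimage of such a ray in [I] is
   an interval. *)
apply: is_interval_measurable => s t /= [sI fs] [tI _] u /andP[su ut].
have uI : u \in I by apply: (@interval_is_interval _ I s t) => //; rewrite su ut.
split=> //; move: fs; rewrite !in_itv/= !andbT => fs.
exact/(le_trans fs)/ndf.
Qed.

(** Jordan decomposition: on [[a, b]], [f] is a difference of two nondecreasing functions. The
    positive part is the negative part of [\- f]. *)
Lemma bounded_variation_measurable {R : realType} (a b : R) (f : R -> R) :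
  bounded_variation a b f -> measurable_fun `[a, b] f.
Proof.
move=> bvf.
apply: (@eq_measurable_fun _ _ _ _ _
    ((fine \o pos_tv a f) \- (fine \o neg_tv a f))) => [x|].
  by rewrite inE/= => xab; rewrite (bounded_variation_pos_neg_tvE bvf).
apply: measurable_funB; apply: nondecreasing_in_measurable.
  exact/fine_neg_tv_nondecreasing/bounded_variationN.
exact: fine_neg_tv_nondecreasing.
Qed.

Lemma bounded_variation_dist {R : realType} (a b x : R) (f : R -> R) :
  bounded_variation a b f -> a <= x <= b ->
  `|f x - f a| <= fine (total_variation a b f).
Proof.
move=> bvf /andP[ax xb].
have tvfin : total_variation a b f \is a fin_num.
  exact/bounded_variationP/bvf/(le_trans ax xb).
rewrite -lee_fin fineK// (le_trans (total_variation_ge f ax))//.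
by rewrite (total_variationD f ax xb) leeDl// total_variation_ge0.
Qed.

Lemma bounded_variation_integrable {R : realType} (a b : R) (f : R -> R) :
  bounded_variation a b f ->
  (@lebesgue_measure R).-integrable `[a, b] (EFin \o f).
Proof.
move=> bvf; apply: measurable_bounded_integrable => //.
- by rewrite /= lebesgue_measure_itv/=; case: ifPn => // _; rewrite -EFinB ltry.
- exact: bounded_variation_measurable.
exists (`|f a| + fine (total_variation a b f)); split=> [|M ltM x /=].
  exact: num_real.
rewrite in_itv/= => xab; apply: le_trans (ltW ltM).
rewrite -[in leLHS](subrK (f a) (f x)) addrC (le_trans (ler_normD _ _))//.
by rewrite lerD2l bounded_variation_dist.
Qed.

(** The rectangle is the integral of the constant [f a], from which [f] deviates by at most its
    variation. *)
Lemma bounded_variation_rectangle {R : realType} (a b : R) (f : R -> R) :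
  a <= b -> bounded_variation a b f ->
  `|(b - a) * f a - \int[lebesgue_measure]_(x in `[a, b]) f x|
    <= (b - a) * fine (total_variation a b f).
Proof.
move=> ab bvf; set mu := @lebesgue_measure R.
have intc (c : R) : mu.-integrable `[a, b] (EFin \o cst c).
  apply: continuous_compact_integrable; first exact: segment_compact.
  exact/continuous_subspaceT/cst_continuous.
have cstE (c : R) : (b - a) * c = \int[mu]_(x in `[a, b]) c.
  rewrite Rintegral_cst// mulrC; congr (_ * _).
  (* The measure is given by cases on [a < b]; the other case forces [a = b]. *)
  rewrite /= lebesgue_measure_itv/= lte_fin; case: ltP => //= ba.
  by apply/eqP; rewrite subr_eq0 eq_le ba.
have intf : mu.-integrable `[a, b] (EFin \o f).
  exact: bounded_variation_integrable.
have intd : mu.-integrable `[a, b] (EFin \o (cst (f a) \- f)).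
  by rewrite -[X in _.-integrable _ X]/((EFin \o cst (f a)) \- (EFin \o f))%E;
    apply: integrableB.
rewrite !cstE -RintegralB//; last exact: intc.
apply: (le_trans (le_normr_Rintegral _ intd)) => //.
apply: le_Rintegral => //; [exact: integrable_norm|exact: intc|].
by move=> x /=; rewrite in_itv/= => xab; rewrite distrC bounded_variation_dist.
Qed.

(** * The difference D between sum and integral *)

Definition sum_sub_int {R : realType} (f : R -> R) (n : nat) : R :=
  sum_upto f n - int_upto f n.

Lemma sum_sub_int0 {R : realType} (f : R -> R) : sum_sub_int f 0 = 0.
Proof.
by rewrite /sum_sub_int /sum_upto big_geq// /int_upto set_itv1 Rintegral_set1
  subrr.
Qed.

Lemma int_uptoS {R : realType} (f : R -> R) (n : nat) :
  bounded_variation 0 n.+1%:R f ->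
  int_upto f n.+1 =
    int_upto f n + \int[lebesgue_measure]_(x in `[n%:R, n.+1%:R]) f x.
Proof.
move=> bvf; rewrite /int_upto.
have n0 : 0 <= n%:R :> R by [].
have nS : n%:R <= n.+1%:R :> R by rewrite ler_nat.
have intf := @bounded_variation_integrable _ _ _ _ bvf.
apply/eqP; rewrite addrC -subr_eq; apply/eqP.
(* Subtraction leaves the half-open interval from n to n+1; its missing left endpoint is a null
   set. *)
rewrite (Rintegral_itvB intf) ?bnd_simp// Rintegral_itv_obnd_cbnd//.
by apply: integrableS intf => //; apply: subset_itvr; rewrite bnd_simp.
Qed.

Lemma sum_sub_intS {R : realType} (f : R -> R) (n : nat) :
  bounded_variation 0 n.+1%:R f ->
  `|sum_sub_int f n.+1 - sum_sub_int f n|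
    <= fine (total_variation n%:R n.+1%:R f).
Proof.
move=> bvf.
have nS : n%:R <= n.+1%:R :> R by rewrite ler_nat.
have bvn : bounded_variation n%:R n.+1%:R f by apply: bounded_variationr bvf.
have := @bounded_variation_rectangle _ _ _ _ nS bvn.
have -> : n.+1%:R - n%:R = 1 :> R by rewrite -natrB// subSnn.
rewrite !mul1r; apply: le_trans.
rewrite /sum_sub_int /sum_upto big_nat_recr//= (int_uptoS bvf).
set s := \sum_(_ <= _ < _) _; set i := int_upto f n; set j := Rintegral _ _ _.
by have -> : s + f n%:R - (i + j) - (s - i) = f n%:R - j by ring.
Qed.

Lemma sum_sub_int_le {R : realType} (f : R -> R) (n m : nat) :
  bounded_variation 0 m%:R f -> (n <= m)%N ->
  `|sum_sub_int f m - sum_sub_int f n| <= fine (total_variation n%:R m%:R f).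
Proof.
elim: m => [bvf|m IHm bvf].
  by rewrite leqn0 => /eqP ->; rewrite subrr normr0 total_variationxx.
rewrite leq_eqVlt ltnS => /predU1P[->|nm].
  by rewrite subrr normr0 total_variationxx.
have nmR : n%:R <= m%:R :> R by rewrite ler_nat.
have mS : m%:R <= m.+1%:R :> R by rewrite ler_nat.
have bvm : bounded_variation 0 m%:R f by apply: bounded_variationl bvf.
have bvmS : bounded_variation m%:R m.+1%:R f by apply: bounded_variationr bvf.
have bvnm : bounded_variation n%:R m%:R f by apply: bounded_variationr bvm.
rewrite (total_variationD f nmR mS) fineD; last 2 first.
- exact/bounded_variationP.
- exact/bounded_variationP.
rewrite (le_trans (ler_distD (sum_sub_int f m) _ _))// [leRHS]addrC.
by rewrite lerD ?IHm// sum_sub_intS.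
Qed.

(** * Pointwise variation and the Euler constant *)

Lemma total_variation_le_pV {R : realType} (a b : R) (I : interval R)
    (f : R -> R) : a \in I -> b \in I ->
  (total_variation a b f <= pointwise_variation f I)%E.
Proof.
move=> aI bI; apply: ge_ereal_sup => _ [_ [s abs <-] <-].
(* The list [s] of a partition omits its first point [a], so [size s] counts the increments, and the
   default [b] is never read at indices up to [size s]. *)
apply: ereal_sup_ubound; exists (size s), (nth b (a :: s)); split=> // i ls.
  apply: (@interval_is_interval _ I a b) => //.
  by rewrite itv_partition_nth_ge ?itv_partition_nth_le.
by case: abs => /(pathP b)/(_ i ls).
Qed.

Lemma bounded_pV_bounded_variation {R : realType} (a b : R) (I : interval R)
    (f : R -> R) : bounded_pV f I -> a \in I -> b \in I -> a <= b ->
  bounded_variation a b f.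
Proof.
move=> pVfin aI bI ab; apply/bounded_variationP => //.
rewrite ge0_fin_numE ?total_variation_ge0//.
exact/le_lt_trans/pVfin/total_variation_le_pV.
Qed.

(** Since D(0) = 0, D is the series of its own increments. That series converges absolutely: its
    partial sums of norms are at most the variation on [[0, n]], hence at most the pointwise
    variation. *)
Lemma sum_sub_int_cvg {R : realType} (f : R -> R) :
  bounded_pV f `[0, +oo[ -> cvgn (sum_sub_int f).
Proof.
move=> pVf.
have nI (n : nat) : n%:R \in `[0 : R, +oo[ by rewrite in_itv/= andbT.
have I0 : 0 \in `[0 : R, +oo[ := nI 0%N.
have bvf (a b : nat) : (a <= b)%N -> bounded_variation a%:R b%:R f.
  by move=> ab; apply: bounded_pV_bounded_variation (nI a) (nI b) _;
    rewrite ?ler_nat.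
suff : cvgn (series (telescope (sum_sub_int f))).
  by rewrite telescopeK sum_sub_int0; under eq_fun do rewrite subr0.
apply: normed_cvg; apply: nondecreasing_is_cvgn.
  by apply: nondecreasing_series => n _ _ /=.
exists (fine (pointwise_variation f `[0, +oo[)) => _ [n _ <-].
apply: (@le_trans _ _ (fine (total_variation 0 n%:R f))).
  rewrite /normed_series_of /series/=; elim: n => [|n IHn].
    by rewrite big_geq// total_variationxx.
  have nS : n%:R <= n.+1%:R :> R by rewrite ler_nat.
  rewrite big_nat_recr//= (total_variationD f (ler0n R n) nS).
  rewrite fineD; last 2 first.
  - exact/(bounded_variationP _ (ler0n R n))/(bvf 0%N).
  - exact/bounded_variationP/bvf.
  by rewrite lerD// sum_sub_intS//; exact: (bvf 0%N).
have tvpV := @total_variation_le_pV _ _ _ _ f I0 (nI n).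
apply: fine_le => //; first exact/(bounded_variationP _ (ler0n R n))/(bvf 0%N).
by rewrite ge0_fin_numE// (le_trans _ tvpV)// total_variation_ge0.
Qed.

Lemma euler_constant_error {R : realType} (f : R -> R) (n : nat) :
  bounded_pV f `[0, +oo[ ->
  (`|sum_sub_int f n - euler_constant f|%:E
    <= pointwise_variation f `[n%:R, +oo[)%E.
Proof.
move=> pVf; have cvf := @sum_sub_int_cvg _ _ pVf.
have le_pV (m : nat) : (n <= m)%N ->
    (`|sum_sub_int f n - sum_sub_int f m|%:E
      <= pointwise_variation f `[n%:R, +oo[)%E.
  move=> nm; have nmR : n%:R <= m%:R :> R by rewrite ler_nat.
  have bvm : bounded_variation 0 m%:R f.
    apply: (bounded_pV_bounded_variation pVf) => //.
      by rewrite in_itv/= lexx.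
    by rewrite in_itv/= ler0n.
  have bvnm : bounded_variation n%:R m%:R f by apply: bounded_variationr bvm.
  apply: (@le_trans _ _ (total_variation n%:R m%:R f)); last first.
    by apply: total_variation_le_pV; rewrite in_itv/= andbT.
  rewrite -(fineK (proj1 (bounded_variationP f nmR) bvnm)) lee_fin distrC.
  exact: sum_sub_int_le.
(* The value [-oo] is excluded by [le_pV] at m = n, and [+oo] is trivial; only a finite bound needs
   the passage to the limit in m. *)
case: (pointwise_variation _ _) le_pV => [r|_|/(_ n (leqnn n))//]; last first.
  by rewrite leey.
move=> le_r; rewrite lee_fin.
have cvd : `|sum_sub_int f n - sum_sub_int f m| @[m --> \oo] -->
    `|sum_sub_int f n - euler_constant f|.
  by apply: cvg_norm; apply: cvgB; [exact: cvg_cst|exact: cvf].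
rewrite -(cvg_lim (@Rhausdorff R) cvd); apply: limr_le; first exact: cvgP cvd.
by near=> m; rewrite -lee_fin le_r//; near: m; exact: nbhs_infty_ge.
Unshelve. all: by end_near. Qed.

(** * Monotonic functions *)

Lemma monotonic_total_variation {R : realType} (f : R -> R) (I : interval R)
    (a b : R) : monotonic_on f I -> a \in I -> b \in I -> a <= b ->
  total_variation a b f = `|f b - f a|%:E.
Proof.
have nd (g : R -> R) : {in I &, {homo g : x y / x <= y}} ->
    a \in I -> b \in I -> a <= b -> total_variation a b g = `|g b - g a|%:E.
  move=> ndg aI bI ab; rewrite nondecreasing_total_variation//.
    by rewrite ger0_norm// subr_ge0 ndg.
  move=> x y; rewrite !in_itv => xab yab.
  by apply: ndg; exact: (@interval_is_interval _ I a b).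
(* The nonincreasing case passes to [\- f], which has the same variation. *)
move=> [/nd//|nif] aI bI ab; rewrite -total_variationN nd//.
  by rewrite /= -opprD normrN.
by move=> x y xI yI xy; rewrite lerN2 nif.
Qed.

Lemma nondecreasing_norm_ge {R : realType} (g : R -> R) (x : R) :
  {in `[0, +oo[ &, {homo g : x y / x <= y}} -> 0 <= x -> `|g 0| < `|g x| ->
  \forall n \near \oo, `|g 0| <= `|g n%:R|.
Proof.
move=> ndg x0 ltg.
have inI (y : R) : 0 <= y -> y \in `[0, +oo[ by rewrite in_itv/= andbT.
have g0x : g 0 <= g x by rewrite ndg ?inI.
(* As [g x] is at least [g 0], it cannot lie below [- |g 0|], so its norm can exceed that of [g 0]
   only on the positive side. Beyond [x], monotonicity preserves this. *)
have lt0x : `|g 0| < g x.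
  move: ltg; rewrite ltr_normr => /orP[//|lt_gx].
  by have := lerNnormlW (lexx `|g 0|); lra.
near=> n.
have xn : x <= n%:R by near: n; exact: nbhs_infty_ger.
apply: (le_trans (ltW lt0x)); apply: le_trans (ler_norm _).
by rewrite ndg ?inI.
Unshelve. all: by end_near. Qed.

Lemma monotonic_norm_ge {R : realType} (f : R -> R) :
  monotonic_on f `[0, +oo[ -> ~ [bounded f x | x in `[0, +oo[] ->
  \forall n \near \oo, `|f 0| <= `|f n%:R|.
Proof.
move=> monof unbf.
have [x x0 ltf] : exists2 x, 0 <= x & `|f 0| < `|f x|.
  (* If no such [x] existed, [|f 0|] would bound [f] on the half-line. *)
  apply: contra_notP unbf => noex.
  exists `|f 0|; split=> [|M ltM x /=]; first exact: num_real.
  rewrite in_itv/= andbT => x0; rewrite leNgt; apply/negP => ltMx.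
  by apply: noex; exists x => //; exact: lt_trans ltMx.
case: monof => [ndf|nif]; first exact: nondecreasing_norm_ge ltf.
under eq_near do rewrite -normrN -[leRHS]normrN.
apply: (@nondecreasing_norm_ge _ (\- f) x); rewrite ?normrN//.
by move=> y z yI zI yz; rewrite lerN2 nif.
Qed.

(* f is defined on all of R, but only its values on [0, +oo[ are used. *)
Theorem theorem2p7 (R : realType) (f : R -> R) :
  (bounded_pV f `[0, +oo[ ->
    forall n : nat, exists eps1 : R,
      sum_upto f n = euler_constant f + int_upto f n + eps1
      /\ (`|eps1|%:E <= pointwise_variation f `[n%:R, +oo[)%E)
  /\
  (monotonic_on f `[0, +oo[ ->
    ~ [bounded f x | x in `[0, +oo[] ->
    (fun n : nat => sum_upto f n)
      = (fun n : nat => int_upto f n) +O_\oo (fun n : nat => f n%:R)).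
Proof.
split=> [pVf n|monof unbf].
  exists (sum_sub_int f n - euler_constant f); split.
    by rewrite /sum_sub_int; ring.
  exact: euler_constant_error.
(* The constant 2 comes from |D(n)| <= |f(n) - f(0)| <= |f(n)| + |f(0)|, where eventually |f(0)| <=
   |f(n)|. *)
apply/eqaddOP/bigO_exP; exists 2 => //; near=> n => /=.
have I0 : 0 \in `[0 : R, +oo[ by rewrite in_itv/= lexx.
have In : n%:R \in `[0 : R, +oo[ by rewrite in_itv/= andbT.
have tvE := monotonic_total_variation monof I0 In (ler0n R n).
(* Monotonicity makes the variation finite on each [[0, n]], although [f] is unbounded on the
   half-line. *)
have bvf : bounded_variation 0 n%:R f.
  by apply/bounded_variationP => //; rewrite tvE.
have := @sum_sub_int_le _ _ _ _ bvf (leq0n n).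
rewrite tvE sum_sub_int0 subr0 => /le_trans; apply.
rewrite (le_trans (ler_normB _ _))//.
have : `|f 0| <= `|f n%:R| by near: n; exact: monotonic_norm_ge.
lra.
Unshelve. all: by end_near. Qed.
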